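(* Let $K:T(E)\to E$ be a vertical connection on a differential bundle $\mathsf{q}=(q:E\to M,+_q,0_q,\lambda)$ in a tangent category with negatives. Let $C_K:=c_ET(K)K-T(K)K:T^2(E)\to E$ be its curvature and $R_K(w_1,w_2,s):=w_2T(w_1)T^2(s)C_K$ its curvature tensor. Then for all vector fields $w_1,w_2:M\to T(M)$ on $M$ and every section $s:M\to E$ of $q$, $$R_K(w_1,w_2,s)=\nabla_K(w_1,\nabla_K(w_2,s))-\nabla_K(w_2,\nabla_K(w_1,s))-\nabla_K([w_1,w_2],s),$$ where $\nabla_K(w,s):=wT(s)K$ is the covariant derivative.
   Context: Conventions: composites are written in diagrammatic order ($fg$ means first $f$, then $g$). $\langle f,g\rangle$ is the induced map into a pullback, $\pi_0,\pi_1$ are projections. Component subscripts of natural transformations are often omitted. An additive bundle over $M$ is a map $q:E\to M$ whose finite wide pullbacks $E_n$ along itself exist, with maps $+_q:E_2\to E$, $0_q:M\to E$ making $q$ a commutative monoid in the slice over $M$. An additive bundle morphism $(f_1,f_0)$ from $q:E\to M$ to $q':E'\to M'$ is a pair $f_1:E\to E'$, $f_0:M\to M'$ with $f_1q'=qf_0$ preserving addition and zero. A tangent category is a category with a functor $T$ and natural transformations $p:T\to 1$, $0:1\to T$, $+:T_2\to T$, $\ell:T\to T^2$, $c:T^2\to T^2$ such that: each $(p_M,+_M,0_M)$ is an additive bundle, the wide pullbacks $T_nM$ of $p_M$ exist and are preserved by each $T^k$; $(\ell_M,0_M)$ is an additive bundle morphism from $(p_M,+_M,0_M)$ to $(T(p_M),T(+_M),T(0_M))$;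 $(c_M,1)$ is an additive bundle morphism from $(T(p_M),T(+_M),T(0_M))$ to $(p_{TM},+_{TM},0_{TM})$; $c^2=1$, $\ell c=\ell$, $\ell_M\ell_{TM}=\ell_MT(\ell_M)$, $T(c)cT(c)=cT(c)c$, $\ell_{TM}T(c_M)c_{TM}=c_MT(\ell_M)$; and the square with top $\mu_M:=\langle\pi_0\ell,\pi_10\rangle T(+):T_2M\to T^2M$, left $\pi_0p=\pi_1p$, right $T(p)$, bottom $0_M$ is a pullback preserved by each $T^k$. It has negatives if there is a natural transformation $n:T\to T$ making each $p_M$ a fibrewise abelian group; $f-g:=\langle f,gn\rangle+$. A differential bundle $\mathsf{q}=(q:E\to M,+_q,0_q,\lambda)$ is an additive bundle with a lift $\lambda:E\to T(E)$ such that: the wide pullbacks $E_n$ are preserved by each $T^k$; for all $n,m$ the pullback of $E_n\to M$ along $T_mM\to M$ exists and is preserved by each $T^k$; $(\lambda,0_M)$ is an additive bundle morphism from $q$ to $(T(q),T(+_q),T(0_q))$; $(\lambda,0_q)$ is an additive bundle morphism from $q$ to $(p_E,+_E,0_E)$; with $\mu:=\langle\pi_0\lambda,\pi_10\rangle T(+_q):E_2\to T(E)$, the square with top $\mu$, left $\pi_0q=\pi_1q:E_2\to M$, right $T(q)$, bottom $0_M$ is a pullback (preserved by each $T^k$); and $\lambda\ell_E=\lambda T(\lambda)$. For $f:X\to T(E)$ with $fT(q)=fpq0$, $\{f\}:X\to E$ denotes $f_{|\mu}\pi_0$ where $f_{|\mu}:X\to E_2$ is the unique map with $f_{|\mu}\mu=f$.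 With negatives, $q$ is a fibrewise abelian group (the negation being $\{\lambda n_E\}$), and differences of maps into $E$ are taken in $q$. The tangent bundle $p_M$ is a differential bundle with lift $\ell_M$, so the bracket applies also to maps $f:X\to T^2(M)$ with $fT(p)=fpp0$, giving $\{f\}:X\to T(M)$. A vector field on $M$ is a section $w:M\to T(M)$ of $p_M$. The Lie bracket of vector fields is $[w_1,w_2]:=\{w_1T(w_2)-w_2T(w_1)c\}:M\to T(M)$, the difference being taken in $p_{T(M)}:T^2(M)\to T(M)$. A vertical connection on $\mathsf{q}$ is a map $K:T(E)\to E$ with $\lambda K=1_E$, $Kq=pq$, $K\lambda=\ell_ET(K)$ and $K\lambda=T(\lambda)c_ET(K)$. *)

(* Defs.v *)
From mathcomp Require Import all_boot.
Set Implicit Arguments.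
Unset Strict Implicit.
Unset Printing Implicit Defensive.

Declare Scope cat_scope.
Delimit Scope cat_scope with cat.
Open Scope cat_scope.

Record category := Category {
  obj :> Type;
  hom : obj -> obj -> Type;
  idmap : forall X, hom X X;
  comp : forall X Y Z, hom X Y -> hom Y Z -> hom X Z;
  compA : forall X Y Z W (f : hom X Y) (g : hom Y Z) (h : hom Z W),
    comp f (comp g h) = comp (comp f g) h;
  comp1m : forall X Y (f : hom X Y), comp (idmap X) f = f;
  compm1 : forall X Y (f : hom X Y), comp f (idmap Y) = f }.

Arguments hom {c} _ _.
Arguments idmap {c} X.
Arguments comp {c X Y Z} f g.

(* Diagrammatic order: [f >> g] is first [f], then [g]. *)
Notation "f >> g" := (comp f g) (at level 50, left associativity) : cat_scope.

Record functor (C D : category) := Functor {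
  fobj :> C -> D;
  fmap : forall X Y, hom X Y -> hom (fobj X) (fobj Y);
  fmap_id : forall X, fmap (idmap X) = idmap (fobj X);
  fmap_comp : forall X Y Z (f : hom X Y) (g : hom Y Z),
    fmap (f >> g) = fmap f >> fmap g }.

Arguments fmap {C D} F {X Y} f : rename.

Definition fid (C : category) : functor C C :=
  {| fobj := fun X => X; fmap := fun X Y f => f;
     fmap_id := fun X => erefl; fmap_comp := fun X Y Z f g => erefl |}.

Lemma fcomp_id (C D B : category) (F : functor C D) (G : functor D B) (X : C) :
  fmap G (fmap F (idmap X)) = idmap (G (F X)).
Proof. by rewrite !fmap_id. Qed.

Lemma fcomp_comp (C D B : category) (F : functor C D) (G : functor D B)
    (X Y Z : C) (f : hom X Y) (g : hom Y Z) :
  fmap G (fmap F (f >> g)) = fmap G (fmap F f) >> fmap G (fmap F g).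
Proof. by rewrite !fmap_comp. Qed.

Definition fcomp (C D B : category) (F : functor C D) (G : functor D B) :
    functor C B :=
  {| fobj := fun X => G (F X); fmap := fun X Y f => fmap G (fmap F f);
     fmap_id := fcomp_id F G; fmap_comp := fcomp_comp F G |}.

Fixpoint fpow (C : category) (F : functor C C) (k : nat) : functor C C :=
  if k is k'.+1 then fcomp (fpow F k') F else fid C.

Record nat_trans (C D : category) (F G : functor C D) := NatTrans {
  component :> forall X : C, hom (F X) (G X);
  naturality : forall (X Y : C) (f : hom X Y),
    fmap F f >> component Y = component X >> fmap G f }.

(* Universal properties are structures carrying the mediating maps; these are
   determined by uniqueness, so the structures contain no further choice. *)

Record is_pullback (C : category) (P A B D : C)
    (top : hom P A) (left : hom P B) (right : hom A D) (bottom : hom B D) :=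
  IsPullback {
    pb_comm : top >> right = left >> bottom;
    pb_lift : forall (X : C) (f : hom X A) (g : hom X B),
      f >> right = g >> bottom -> hom X P;
    pb_lift_top : forall (X : C) (f : hom X A) (g : hom X B)
      (H : f >> right = g >> bottom), pb_lift H >> top = f;
    pb_lift_left : forall (X : C) (f : hom X A) (g : hom X B)
      (H : f >> right = g >> bottom), pb_lift H >> left = g;
    pb_unique : forall (X : C) (u v : hom X P),
      u >> top = v >> top -> u >> left = v >> left -> u = v }.

Record pullback (C : category) (A B D : C) (f : hom A D) (g : hom B D) :=
  Pullback {
    pb_obj : C;
    pb_fst : hom pb_obj A;
    pb_snd : hom pb_obj B;
    pb_is : is_pullback pb_fst pb_snd f g }.

(* The leg to the base is part of the cone, so that for [n = 0] the limit is
   the base itself. *)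
Record is_wide_pullback (C : category) (E M : C) (q : hom E M) (n : nat)
    (P : C) (base : hom P M) (pr : 'I_n -> hom P E) :=
  IsWidePullback {
    wpb_over : forall i, pr i >> q = base;
    wpb_lift : forall (X : C) (b : hom X M) (f : 'I_n -> hom X E),
      (forall i, f i >> q = b) -> hom X P;
    wpb_lift_base : forall (X : C) (b : hom X M) (f : 'I_n -> hom X E)
      (H : forall i, f i >> q = b), wpb_lift H >> base = b;
    wpb_lift_pr : forall (X : C) (b : hom X M) (f : 'I_n -> hom X E)
      (H : forall i, f i >> q = b) (i : 'I_n), wpb_lift H >> pr i = f i;
    wpb_unique : forall (X : C) (u v : hom X P),
      u >> base = v >> base -> (forall i, u >> pr i = v >> pr i) -> u = v }.

Record wide_pullback (C : category) (E M : C) (q : hom E M) (n : nat) :=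
  WidePullback {
    wobj :> C;
    wbase : hom wobj M;
    wpr : 'I_n -> hom wobj E;
    wis : is_wide_pullback q wbase wpr }.

Arguments wbase {C E M q n} w.
Arguments wpr {C E M q n} w i.
Arguments wis {C E M q n} w.

Definition preserves_wpb (C D : category) (F : functor C D) (E M : C)
    (q : hom E M) (n : nat) (W : wide_pullback q n) :=
  is_wide_pullback (fmap F q) (fmap F (wbase W)) (fun i => fmap F (wpr W i)).

Definition map_wpb (C D : category) (F : functor C D) (E M : C)
    (q : hom E M) (n : nat) (W : wide_pullback q n) (HW : preserves_wpb F W) :
    wide_pullback (fmap F q) n :=
  WidePullback HW.

Lemma wpr_over (C : category) (E M : C) (q : hom E M) (n : nat)
    (W : wide_pullback q n) (i j : 'I_n) : wpr W i >> q = wpr W j >> q.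
Proof. by rewrite !(wpb_over (wis W)). Qed.

Definition fam2 (C : category) (X E : C) (f g : hom X E) (i : 'I_2) : hom X E :=
  if i == ord0 then f else g.

Lemma fam2_over (C : category) (X E M : C) (q : hom E M) (f g : hom X E)
    (H : f >> q = g >> q) (i : 'I_2) : fam2 f g i >> q = f >> q.
Proof. by rewrite /fam2; case: ifP. Qed.

Definition pair2 (C : category) (E M : C) (q : hom E M) (W : wide_pullback q 2)
    (X : C) (f g : hom X E) (H : f >> q = g >> q) : hom X W :=
  wpb_lift (wis W) (fam2_over H).

Arguments pair2 {C E M q} W {X f g} H.

Notation pi0 W := (wpr W (ord0 : 'I_2)).
Notation pi1 W := (wpr W (ord_max : 'I_2)).

Lemma pair2_pi0 (C : category) (E M : C) (q : hom E M) (W : wide_pullback q 2)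
    (X : C) (f g : hom X E) (H : f >> q = g >> q) : pair2 W H >> pi0 W = f.
Proof. by rewrite (wpb_lift_pr (wis W)). Qed.

Lemma pair2_pi1 (C : category) (E M : C) (q : hom E M) (W : wide_pullback q 2)
    (X : C) (f g : hom X E) (H : f >> q = g >> q) : pair2 W H >> pi1 W = g.
Proof. by rewrite (wpb_lift_pr (wis W)). Qed.

Lemma ord2P (i : 'I_2) : i = ord0 \/ i = ord_max.
Proof. by case: i => [[|[|]]] // Hi; [left|right]; apply: val_inj. Qed.

Lemma pair2_unique (C : category) (E M : C) (q : hom E M)
    (W : wide_pullback q 2) (X : C) (u v : hom X W) :
  u >> pi0 W = v >> pi0 W -> u >> pi1 W = v >> pi1 W -> u = v.
Proof.
move=> H0 H1; apply: (wpb_unique (wis W)).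
  by rewrite -(wpb_over (wis W) ord0) !compA H0.
by move=> i; case: (ord2P i) => ->.
Qed.

Definition fadd (C : category) (E M : C) (q : hom E M) (W : wide_pullback q 2)
    (a : hom W E) (X : C) (f g : hom X E) (H : f >> q = g >> q) : hom X E :=
  pair2 W H >> a.

Arguments fadd {C E M q} W a {X f g} H.

Lemma fadd_congr (C : category) (E M : C) (q : hom E M)
    (W : wide_pullback q 2) (a : hom W E) (X : C) (f g f' g' : hom X E)
    (H : f >> q = g >> q) (H' : f' >> q = g' >> q) :
  f = f' -> g = g' -> fadd W a H = fadd W a H'.
Proof.
move=> Hf Hg; rewrite /fadd; congr (_ >> _).
by apply: pair2_unique; rewrite ?pair2_pi0 ?pair2_pi1.
Qed.

Lemma fadd_pre (C : category) (E M : C) (q : hom E M)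
    (W : wide_pullback q 2) (a : hom W E) (X Y : C) (u : hom Y X)
    (f g : hom X E) (H : f >> q = g >> q)
    (H' : (u >> f) >> q = (u >> g) >> q) :
  u >> fadd W a H = fadd W a H'.
Proof.
rewrite /fadd compA; congr (_ >> _).
by apply: pair2_unique; rewrite -?compA ?pair2_pi0 ?pair2_pi1.
Qed.

Lemma fadd_over (C : category) (E M : C) (q : hom E M)
    (W : wide_pullback q 2) (a : hom W E) (Ha : a >> q = wbase W)
    (X : C) (f g : hom X E) (H : f >> q = g >> q) :
  fadd W a H >> q = f >> q.
Proof. by rewrite /fadd -compA Ha (wpb_lift_base (wis W)). Qed.

Lemma zero_over_eq (C : category) (E M : C) (q : hom E M) (z : hom M E)
    (Hz : z >> q = idmap M) : idmap E >> q = (q >> z) >> q.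
Proof. by rewrite -compA Hz comp1m compm1. Qed.

Notation pi3 W i := (wpr W (@Ordinal 3 i isT)).

Record commutative_monoid_over (C : category) (E M : C) (q : hom E M)
    (W : forall n, wide_pullback q n) (a : hom (W 2) E) (z : hom M E) : Prop :=
  CommutativeMonoidOver {
    cm_add_over : a >> q = wbase (W 2);
    cm_zero_over : z >> q = idmap M;
    cm_addA :
      fadd (W 2) a (f := fadd (W 2) a (f := pi3 (W 3) 0) (g := pi3 (W 3) 1)
                           (wpr_over _ _ _))
                   (g := pi3 (W 3) 2)
        (etrans (fadd_over cm_add_over _) (wpr_over _ _ _))
      = fadd (W 2) a (f := pi3 (W 3) 0)
             (g := fadd (W 2) a (f := pi3 (W 3) 1) (g := pi3 (W 3) 2)
                     (wpr_over _ _ _))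
          (etrans (wpr_over _ _ _) (esym (fadd_over cm_add_over _)));
    cm_addC : fadd (W 2) a (f := pi1 (W 2)) (g := pi0 (W 2)) (wpr_over _ _ _) = a;
    cm_add0 : fadd (W 2) a (f := idmap E) (g := q >> z)
                (zero_over_eq cm_zero_over) = idmap E }.

Record additive_bundle (C : category) (E M : C) := AdditiveBundle {
  bproj :> hom E M;
  bpow : forall n, wide_pullback bproj n;
  badd : hom (bpow 2) E;
  bzero : hom M E;
  bmonoid : commutative_monoid_over badd bzero }.

Arguments bpow {C E M} a n.
Arguments badd {C E M} a.
Arguments bzero {C E M} a.
Arguments bmonoid {C E M} a.

Definition bsum (C : category) (E M : C) (q : additive_bundle E M) (X : C)
    (f g : hom X E) (H : f >> q = g >> q) : hom X E :=
  fadd (bpow q 2) (badd q) H.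

Arguments bsum {C E M} q {X f g} H.

Lemma bsum_over (C : category) (E M : C) (q : additive_bundle E M) (X : C)
    (f g : hom X E) (H : f >> q = g >> q) : bsum q H >> q = f >> q.
Proof. exact: fadd_over (cm_add_over (bmonoid q)) _ _ _ _. Qed.

Lemma bsumC (C : category) (E M : C) (q : additive_bundle E M) (X : C)
    (f g : hom X E) (H : f >> q = g >> q) (H' : g >> q = f >> q) :
  bsum q H = bsum q H'.
Proof.
rewrite /bsum /fadd -{1}(cm_addC (bmonoid q)) /fadd compA; congr (_ >> _).
by apply: pair2_unique; rewrite -compA !(pair2_pi0, pair2_pi1).
Qed.

Lemma bsum0 (C : category) (E M : C) (q : additive_bundle E M) (X : C)
    (f : hom X E) (H : f >> q = (f >> q >> bzero q) >> q) :
  bsum q H = f.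
Proof.
have H0 := zero_over_eq (cm_zero_over (bmonoid q)).
have K : (f >> idmap _) >> q = (f >> (q >> bzero q)) >> q.
  by rewrite compm1 compA.
transitivity (f >> idmap E); last exact: compm1.
rewrite -[in RHS](cm_add0 (bmonoid q)) (fadd_pre _ _ K).
by apply: fadd_congr; rewrite ?compm1 ?compA.
Qed.

Lemma bzero_over (C : category) (E M : C) (q : additive_bundle E M) :
  bzero q >> q = idmap M.
Proof. exact: cm_zero_over (bmonoid q). Qed.

Lemma square_pi (C : category) (E M E' M' : C) (q : hom E M) (q' : hom E' M')
    (f1 : hom E E') (f0 : hom M M') (H : f1 >> q' = q >> f0)
    (n : nat) (W : wide_pullback q n) (i j : 'I_n) :
  (wpr W i >> f1) >> q' = (wpr W j >> f1) >> q'.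
Proof. by rewrite -!compA H !compA (wpr_over W i j). Qed.

Record additive_morphism (C : category) (E M E' M' : C)
    (q : additive_bundle E M) (q' : additive_bundle E' M')
    (f1 : hom E E') (f0 : hom M M') : Prop := AdditiveMorphism {
  am_square : f1 >> q' = q >> f0;
  am_add : badd q >> f1
    = bsum q' (f := pi0 (bpow q 2) >> f1) (g := pi1 (bpow q 2) >> f1)
        (square_pi am_square _ _ _);
  am_zero : bzero q >> f1 = f0 >> bzero q' }.

Section MapBundle.
Variables (C D : category) (F : functor C D) (E M : C).
Variable q : additive_bundle E M.
Variable HF : forall n, preserves_wpb F (bpow q n).

Let FW n := map_wpb (HF n).

Lemma fmap_over (X : C) (f g : hom X E) (H : f >> q = g >> q) :
  fmap F f >> fmap F q = fmap F g >> fmap F q.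
Proof. by rewrite -!fmap_comp H. Qed.

Lemma fmap_fadd (X : C) (f g : hom X E) (H : f >> q = g >> q)
    (f' g' : hom (F X) (F E)) (H' : f' >> fmap F q = g' >> fmap F q) :
  f' = fmap F f -> g' = fmap F g ->
  fadd (FW 2) (fmap F (badd q)) H' = fmap F (bsum q H).
Proof.
move=> Hf Hg; rewrite /bsum /fadd fmap_comp; congr (_ >> _).
apply: pair2_unique.
  by rewrite pair2_pi0 /= -fmap_comp pair2_pi0.
by rewrite pair2_pi1 /= -fmap_comp pair2_pi1.
Qed.

Lemma map_monoid :
  @commutative_monoid_over D (F E) (F M) (fmap F q) FW
    (fmap F (badd q)) (fmap F (bzero q)).
Proof.
have Ha : fmap F (badd q) >> fmap F q = wbase (FW 2).
  by rewrite -fmap_comp (cm_add_over (bmonoid q)).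
have Hz : fmap F (bzero q) >> fmap F q = idmap (F M).
  by rewrite -fmap_comp bzero_over fmap_id.
refine (@CommutativeMonoidOver D _ _ _ FW _ _ Ha Hz _ _ _).
- refine (etrans (fmap_fadd _ _ _ _) (etrans (congr1 (fmap F)
    (cm_addA (bmonoid q))) (esym (fmap_fadd _ _ _ _)))) => //.
  + exact: fmap_fadd.
  + exact: fmap_fadd.
- by refine (etrans (fmap_fadd _ _ _ _)
    (congr1 (fmap F) (cm_addC (bmonoid q)))).
- refine (etrans (fmap_fadd _ _ _ _)
    (etrans (congr1 (fmap F) (cm_add0 (bmonoid q))) (fmap_id F _))).
    by rewrite fmap_id.
  by rewrite fmap_comp.
Qed.

Definition map_bundle : additive_bundle (F E) (F M) :=
  AdditiveBundle map_monoid.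
End MapBundle.

Section PowerFunctor.
Variables (C : category) (T : functor C C) (p : nat_trans T (fid C)).
Variables (n : nat) (W : forall M : C, wide_pullback (p M) n).

Lemma power_map_over (M N : C) (f : hom M N) (i : 'I_n) :
  (wpr (W M) i >> fmap T f) >> p N = wbase (W M) >> f.
Proof. by rewrite -compA (naturality p) compA (wpb_over (wis (W M))). Qed.

Definition power_map (M N : C) (f : hom M N) : hom (W M) (W N) :=
  wpb_lift (wis (W N)) (power_map_over f).

Lemma power_map_id (M : C) : power_map (idmap M) = idmap (W M).
Proof.
apply: (wpb_unique (wis (W M))).
  by rewrite (wpb_lift_base (wis (W M))) comp1m compm1.
by move=> i; rewrite (wpb_lift_pr (wis (W M))) fmap_id comp1m compm1.
Qed.

Lemma power_map_comp (M N P : C) (f : hom M N) (g : hom N P) :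
  power_map (f >> g) = power_map f >> power_map g.
Proof.
apply: (wpb_unique (wis (W P))).
  rewrite -compA !(wpb_lift_base (wis (W P))) !compA.
  by rewrite (wpb_lift_base (wis (W N))).
move=> i; rewrite -compA !(wpb_lift_pr (wis (W P))) fmap_comp !compA.
by rewrite (wpb_lift_pr (wis (W N))).
Qed.

Definition power_functor : functor C C :=
  {| fobj := fun M => W M; fmap := power_map;
     fmap_id := power_map_id; fmap_comp := power_map_comp |}.
End PowerFunctor.

(* The part of a tangent structure that does not involve [l] and [c]. *)
Record additive_tangent (C : category) := AdditiveTangent {
  tT :> functor C C;
  tp : nat_trans tT (fid C);
  tpow : forall (M : C) (n : nat), wide_pullback (tp M) n;
  tpow_preserved : forall (M : C) (n k : nat),
    preserves_wpb (fpow tT k) (tpow M n);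
  tzero : nat_trans (fid C) tT;
  tadd : nat_trans (power_functor (fun M => tpow M 2)) tT;
  tmonoid : forall M : C,
    commutative_monoid_over (W := tpow M) (tadd M) (tzero M) }.

Arguments tp {C} a.
Arguments tpow {C} a M n.
Arguments tpow_preserved {C} a M n k.
Arguments tzero {C} a.
Arguments tadd {C} a.
Arguments tmonoid {C} a M.

Definition tan_bundle (C : category) (T : additive_tangent C) (M : C) :
    additive_bundle (T M) M :=
  AdditiveBundle (tmonoid T M).

Arguments tan_bundle {C} T M.

(* [fpow T 1] is convertible to [T]. *)
Definition Ttan_bundle (C : category) (T : additive_tangent C) (M : C) :
    additive_bundle (T (T M)) (T M) :=
  map_bundle (q := tan_bundle T M) (fun n => tpow_preserved T M n 1).

Arguments Ttan_bundle {C} T M.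

(* [mu] is the sum of [pi0 >> lam] and [pi1 >> 0] in the image of [q] under
   [T], whose addition is [fmap T (badd q)]. *)
Section Mu.
Variables (C : category) (T : additive_tangent C) (E M : C).
Variable q : additive_bundle E M.
Variable HT : forall n, preserves_wpb T (bpow q n).
Variable lam : hom E (T E).
Hypothesis lam_over : lam >> fmap T q = q >> tzero T M.

Lemma mu_over :
  (pi0 (bpow q 2) >> lam) >> fmap T q
  = (pi1 (bpow q 2) >> tzero T E) >> fmap T q.
Proof.
rewrite -!compA lam_over -(naturality (tzero T)) /= !compA.
by rewrite (wpr_over _ ord0 ord_max).
Qed.

Definition mu : hom (bpow q 2) (T E) := bsum (map_bundle HT) mu_over.
End Mu.

(* The square with top [mu], left [pi0 >> q], right [fmap T q] and bottom
   [tzero T M] is sent to a pullback by the [k]-th power of [T]. *)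
Definition lift_universal (C : category) (T : additive_tangent C) (E M : C)
    (q : additive_bundle E M) (HT : forall n, preserves_wpb T (bpow q n))
    (lam : hom E (T E)) (Hlam : lam >> fmap T q = q >> tzero T M) (k : nat) :=
  is_pullback (fmap (fpow T k) (mu HT Hlam))
    (fmap (fpow T k) (pi0 (bpow q 2) >> q))
    (fmap (fpow T k) (fmap T q)) (fmap (fpow T k) (tzero T M)).

Record tangent_structure (C : category) := TangentStructure {
  ts_base :> additive_tangent C;
  tl : nat_trans ts_base (fcomp ts_base ts_base);
  tc : nat_trans (fcomp ts_base ts_base) (fcomp ts_base ts_base);
  tl_additive : forall M : C,
    additive_morphism (tan_bundle ts_base M) (Ttan_bundle ts_base M)
      (tl M) (tzero ts_base M);
  tc_additive : forall M : C,
    additive_morphism (Ttan_bundle ts_base M) (tan_bundle ts_base (ts_base M))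
      (tc M) (idmap (ts_base M));
  tc_tc : forall M : C, tc M >> tc M = idmap (ts_base (ts_base M));
  tl_tc : forall M : C, tl M >> tc M = tl M;
  tl_tl : forall M : C, tl M >> tl (ts_base M) = tl M >> fmap ts_base (tl M);
  tc_braid : forall M : C,
    fmap ts_base (tc M) >> tc (ts_base M) >> fmap ts_base (tc M)
    = tc (ts_base M) >> fmap ts_base (tc M) >> tc (ts_base M);
  tl_tc_braid : forall M : C,
    tl (ts_base M) >> fmap ts_base (tc M) >> tc (ts_base M)
    = tc M >> fmap ts_base (tl M);
  tl_universal : forall (M : C) (k : nat),
    lift_universal (q := tan_bundle ts_base M)
      (fun n => tpow_preserved ts_base M n 1)
      (am_square (tl_additive M)) k }.

Arguments tl {C} t.
Arguments tc {C} t.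

Lemma tan_idmap_over (C : category) (T : additive_tangent C) (M : C)
    (n : hom (T M) (T M)) (H : n >> tp T M = tp T M) :
  idmap (T M) >> tp T M = n >> tp T M.
Proof. by rewrite H comp1m. Qed.

Record negatives (C : category) (T : additive_tangent C) := Negatives {
  tn :> nat_trans T T;
  tn_over : forall M : C, tn M >> tp T M = tp T M;
  tn_add : forall M : C,
    bsum (tan_bundle T M) (f := idmap (T M)) (g := tn M)
      (tan_idmap_over (tn_over M)) = tp T M >> tzero T M }.

Record differential_bundle (C : category) (T : tangent_structure C) (E M : C) :=
  DifferentialBundle {
    db_bundle :> additive_bundle E M;
    db_pow_preserved : forall n k : nat,
      preserves_wpb (fpow T k) (bpow db_bundle n);
    db_tpb : forall n m : nat,
      pullback (wbase (bpow db_bundle n)) (wbase (tpow T M m));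
    db_tpb_preserved : forall n m k : nat,
      is_pullback (fmap (fpow T k) (pb_fst (db_tpb n m)))
        (fmap (fpow T k) (pb_snd (db_tpb n m)))
        (fmap (fpow T k) (wbase (bpow db_bundle n)))
        (fmap (fpow T k) (wbase (tpow T M m)));
    lam : hom E (T E);
    lam_additive_T :
      additive_morphism db_bundle
        (map_bundle (F := T) (fun n => db_pow_preserved n 1))
        lam (tzero T M);
    lam_additive_p :
      additive_morphism db_bundle (tan_bundle T E) lam (bzero db_bundle);
    lam_universal : forall k : nat,
      lift_universal (q := db_bundle) (fun n => db_pow_preserved n 1)
        (am_square lam_additive_T) k;
    lam_lam : lam >> tl T E = lam >> fmap T lam }.

Arguments lam {C T E M} d.

Section Bracket.
Variables (C : category) (T : additive_tangent C) (E M : C).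
Variable q : additive_bundle E M.
Variable HT : forall n, preserves_wpb T (bpow q n).
Variable l : hom E (T E).
Hypothesis l_over : l >> fmap T q = q >> tzero T M.
Hypothesis univ : lift_universal HT l_over 0.

(* [pb_lift univ Hf] is the unique factorisation of [f] through [mu]: its
   component to the base is forced to be [f >> tp T E >> q]. *)
Definition bracket (X : C) (f : hom X (T E))
    (Hf : f >> fmap T q = f >> tp T E >> q >> tzero T M) : hom X E :=
  pb_lift univ Hf >> pi0 (bpow q 2).

Lemma bracket_proj (X : C) (f : hom X (T E))
    (Hf : f >> fmap T q = f >> tp T E >> q >> tzero T M) :
  bracket Hf >> q = f >> tp T E >> q.
Proof. by rewrite /bracket -compA; apply: (pb_lift_left univ Hf). Qed.
End Bracket.

Definition tan_bracket (C : category) (T : tangent_structure C) (M X : C)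
    (f : hom X (T (T M)))
    (Hf : f >> fmap T (tp T M) = f >> tp T (T M) >> tp T M >> tzero T M) :
    hom X (T M) :=
  bracket (q := tan_bundle T M) (tl_universal T M 0) Hf.

Definition db_bracket (C : category) (T : tangent_structure C) (E M : C)
    (q : differential_bundle T E M) (X : C) (f : hom X (T E))
    (Hf : f >> fmap T q = f >> tp T E >> q >> tzero T M) : hom X E :=
  bracket (lam_universal q 0) Hf.

Section TangentDifference.
Variables (C : category) (T : additive_tangent C) (n : negatives T) (M : C).

Lemma tsub_over (X : C) (f g : hom X (T M)) (H : f >> tp T M = g >> tp T M) :
  f >> tp T M = (g >> n M) >> tp T M.
Proof. by rewrite -compA tn_over. Qed.

Definition tsub (X : C) (f g : hom X (T M)) (H : f >> tp T M = g >> tp T M) :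
    hom X (T M) :=
  bsum (tan_bundle T M) (tsub_over H).

Lemma tsub_proj (X : C) (f g : hom X (T M)) (H : f >> tp T M = g >> tp T M) :
  tsub H >> tp T M = f >> tp T M.
Proof. exact: bsum_over. Qed.

Lemma tsubff (X : C) (f : hom X (T M)) (H : f >> tp T M = f >> tp T M) :
  tsub H = f >> tp T M >> tzero T M.
Proof.
have K : (f >> idmap _) >> tp T M = (f >> n M) >> tp T M.
  by rewrite compm1; exact: tsub_over.
rewrite -compA -(tn_add n M) /bsum (fadd_pre _ _ K).
by apply: fadd_congr; rewrite ?compm1.
Qed.

Lemma tzero_tn : tzero T M >> n M = tzero T M.
Proof.
have Hz : tzero T M >> tp T M = idmap M := bzero_over (tan_bundle T M).
have Hn : (tzero T M >> n M) >> tp T M = idmap M by rewrite -compA tn_over.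
have H : tzero T M >> tp T M = tzero T M >> tp T M by [].
have H0 : (tzero T M >> n M) >> tp T M = tzero T M >> tp T M by rewrite Hn.
rewrite -(bsum0 (q := tan_bundle T M) (f := tzero T M >> n M)).
  by rewrite /= Hn comp1m.
move=> H1; transitivity (bsum (tan_bundle T M) H0).
  by apply: fadd_congr; rewrite //= Hn comp1m.
rewrite (bsumC (q := tan_bundle T M) H0 (esym H0)).
transitivity (tsub H); first exact: fadd_congr.
by rewrite tsubff Hz comp1m.
Qed.

End TangentDifference.

Lemma tsub_fmap (C : category) (T : additive_tangent C) (n : negatives T)
    (M N X : C) (h : hom M N) (f g : hom X (T M))
    (H : f >> tp T M = g >> tp T M)
    (H' : (f >> fmap T h) >> tp T N = (g >> fmap T h) >> tp T N) :
  tsub n H >> fmap T h = tsub n H'.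
Proof.
rewrite /tsub /bsum /fadd /= -compA -(naturality (tadd T)) /= compA.
congr (_ >> _); apply: pair2_unique.
  rewrite pair2_pi0 -compA (wpb_lift_pr (wis (tpow T N 2))) compA.
  by rewrite pair2_pi0.
rewrite pair2_pi1 -compA (wpb_lift_pr (wis (tpow T N 2))) compA.
by rewrite pair2_pi1 -!compA (naturality n).
Qed.

Section BundleDifference.
Variables (C : category) (T : tangent_structure C) (n : negatives T).
Variables (E M : C) (q : differential_bundle T E M).

Lemma lam_p : lam q >> tp T E = q >> bzero q.
Proof. exact: am_square (lam_additive_p q). Qed.

Lemma db_neg_over :
  (lam q >> n E) >> fmap T q = (lam q >> n E) >> tp T E >> q >> tzero T M.
Proof.
have Hq : lam q >> fmap T q = q >> tzero T M := am_square (lam_additive_T q).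
rewrite -!compA -(naturality n) !compA Hq -compA tzero_tn.
rewrite -(compA _ (n E)) tn_over lam_p -(compA q) bzero_over compm1 //.
Qed.

(* The negation of [q] is the bracket of [lam q >> n E]. *)
Definition db_neg : hom E E := db_bracket db_neg_over.

Lemma db_neg_proj : db_neg >> q = q.
Proof.
rewrite /db_neg /db_bracket bracket_proj -(compA _ (n E)) tn_over lam_p.
by rewrite -compA bzero_over compm1.
Qed.

Lemma db_sub_over (X : C) (f g : hom X E) (H : f >> q = g >> q) :
  f >> q = (g >> db_neg) >> q.
Proof. by rewrite -compA db_neg_proj. Qed.

Definition db_sub (X : C) (f g : hom X E) (H : f >> q = g >> q) : hom X E :=
  bsum q (db_sub_over H).

Lemma db_sub_proj (X : C) (f g : hom X E) (H : f >> q = g >> q) :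
  db_sub H >> q = f >> q.
Proof. exact: bsum_over. Qed.
End BundleDifference.

Record bsection (C : category) (E M : C) (q : hom E M) := BSection {
  sec :> hom M E;
  sec_proj : sec >> q = idmap M }.

Definition vector_field (C : category) (T : additive_tangent C) (M : C) :=
  @bsection C (T M) M (tp T M).

Section VectorFields.
Variables (C : category) (T : tangent_structure C) (M : C).
Variables w1 w2 : vector_field T M.

Lemma tc_Tp : tc T M >> fmap T (tp T M) = tp T (T M).
Proof.
rewrite -[RHS]comp1m -(tc_tc T M) -compA.
have /= -> := am_square (tc_additive T M).
by rewrite compm1.
Qed.

Lemma vf_Tp : w1 >> fmap T w2 >> fmap T (tp T M) = w1.
Proof. by rewrite -compA -(fmap_comp T) sec_proj fmap_id compm1. Qed.

Lemma vf_p : w1 >> fmap T w2 >> tp T (T M) = w2.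
Proof. by rewrite -compA (naturality (tp T)) /= compA sec_proj comp1m. Qed.
End VectorFields.

Section LieBracket.
Variables (C : category) (T : tangent_structure C) (n : negatives T) (M : C).
Variables w1 w2 : vector_field T M.

Lemma lie_sub_over :
  (w1 >> fmap T w2) >> tp T (T M)
  = (w2 >> fmap T w1 >> tc T M) >> tp T (T M).
Proof.
rewrite vf_p -(compA _ (tc T M)).
have /= -> := am_square (tc_additive T M).
by rewrite compm1 vf_Tp.
Qed.

Lemma lie_bracket_over :
  tsub n lie_sub_over >> fmap T (tp T M)
  = tsub n lie_sub_over >> tp T (T M) >> tp T M >> tzero T M.
Proof.
rewrite tsub_proj vf_p sec_proj comp1m.
have E1 : (w1 >> fmap T w2) >> fmap T (tp T M) = w1 := vf_Tp w1 w2.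
have E2 : (w2 >> fmap T w1 >> tc T M) >> fmap T (tp T M) = w1.
  by rewrite -compA tc_Tp vf_p.
have H : ((w1 >> fmap T w2) >> fmap T (tp T M)) >> tp T M
   = ((w2 >> fmap T w1 >> tc T M) >> fmap T (tp T M)) >> tp T M.
  by rewrite E1 E2.
rewrite (tsub_fmap n lie_sub_over H).
have H1 : w1 >> tp T M = w1 >> tp T M by [].
transitivity (tsub n H1); first by apply: fadd_congr; rewrite ?E1 ?E2.
by rewrite tsubff sec_proj comp1m.
Qed.

Lemma lie_bracket_proj : tan_bracket lie_bracket_over >> tp T M = idmap M.
Proof.
rewrite /tan_bracket (bracket_proj (q := tan_bundle T M)) /=.
by rewrite tsub_proj vf_p sec_proj.
Qed.

Definition lie_bracket : vector_field T M := BSection lie_bracket_proj.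
End LieBracket.

Record vertical_connection (C : category) (T : tangent_structure C) (E M : C)
    (q : differential_bundle T E M) := VerticalConnection {
  vc :> hom (T E) E;
  vc_retract : lam q >> vc = idmap E;
  vc_proj : vc >> q = tp T E >> q;
  vc_linear_p : vc >> lam q = tl T E >> fmap T vc;
  vc_linear_T : vc >> lam q = fmap T (lam q) >> tc T E >> fmap T vc }.

Section Curvature.
Variables (C : category) (T : tangent_structure C) (n : negatives T).
Variables (E M : C) (q : differential_bundle T E M).
Variable K : vertical_connection q.

Lemma nabla_proj (w : vector_field T M) (s : bsection q) :
  (w >> fmap T s >> K) >> q = idmap M.
Proof.
rewrite -compA vc_proj compA -(compA w) (naturality (tp T)) /= compA.
by rewrite sec_proj comp1m sec_proj.
Qed.

Definition nabla (w : vector_field T M) (s : bsection q) : bsection q :=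
  BSection (nabla_proj w s).

Lemma curvature_over :
  (tc T E >> fmap T K >> K) >> q = (fmap T K >> K) >> q.
Proof.
rewrite -!compA vc_proj !compA -!(compA _ (fmap T K)) (naturality (tp T)) /=.
rewrite !compA.
have /= -> := am_square (tc_additive T E).
rewrite compm1 -!(compA _ K) vc_proj !compA.
by rewrite (naturality (tp T)).
Qed.

Definition curvature : hom (T (T E)) E := db_sub n curvature_over.

Definition curvature_tensor (w1 w2 : vector_field T M) (s : bsection q) :
    hom M E :=
  w2 >> fmap T w1 >> fmap T (fmap T s) >> curvature.

Lemma section_sub_over (s t : bsection q) : s >> q = t >> q.
Proof. by rewrite !sec_proj. Qed.

Lemma section_sub_proj (s t : bsection q) :
  db_sub n (section_sub_over s t) >> q = idmap M.
Proof. by rewrite db_sub_proj sec_proj. Qed.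

Definition section_sub (s t : bsection q) : bsection q :=
  BSection (section_sub_proj s t).
End Curvature.

(* Main.v *)
From mathcomp Require Import all_boot.
Require Import Defs.
Set Implicit Arguments.
Unset Strict Implicit.
Unset Printing Implicit Defensive.

(** Write [h := fmap T s >> K], so that [nabla K w s = w >> h], and put
    [a := w1 >> fmap T w2] and [b := w2 >> fmap T w1 >> tc T M].  Naturality
    of [c] turns the two terms of the curvature tensor into
    [b >> fmap T h >> K] and [nabla K w2 (nabla K w1 s)], whereas
    [a >> fmap T h >> K] is [nabla K w1 (nabla K w2 s)].  The theorem therefore
    compares the values of [fmap T h >> K] at [a] and at [b]: it says that they
    differ by [[w1, w2] >> h].

    The difference [d] of [a] and [b] in the bundle [p] over [T M] is vertical
    for [T(p)], and by definition of the Lie bracket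
    [d = [w1, w2] l + w2 0], where the sum is taken in [T(p)]
    ([bracket_decomposition]).  Now [K] is additive for both structures on
    [T E]: from [p] to [q] ([vc_sums_p]) and from [T(q)] to [q] ([vc_sums_T]).
    The first gives [a T(h) K = b T(h) K + d T(h) K].  It also makes [h]
    additive, so that the second applies to the decomposition of [d]; its zero
    term disappears, and [d T(h) K = [w1, w2] l T(h) K], which is [[w1, w2] h]
    because [l T(h) K = h] ([tl_covariant]).  What remains is a cancellation in
    the fibrewise abelian group [q].

    Both additivities of [K] come from the two linearity axioms by composing
    with [lam]: the lift is additive and, by universality, it also reflects
    sums ([lam_reflects_sums]), while [l], [c] and [fmap T K] are additive. *)

(** * Sums in an additive bundle *)

Section Sums.
Variables (C : category) (E M : C) (q : additive_bundle E M).

(** Addition is treated as a relation, witnessed by a map into [E_2].  The sum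
    [bsum] carries a proof that its arguments lie over the same map; here that
    proof is implicit in the witness, so sums can be rewritten freely and
    transported along maps by composing the witness. *)
Definition is_sum (X : C) (f g h : hom X E) : Prop :=
  exists u : hom X (bpow q 2),
    [/\ u >> pi0 (bpow q 2) = f, u >> pi1 (bpow q 2) = g & u >> badd q = h].

Lemma is_sum_fadd (X : C) (f g : hom X E) (H : f >> q = g >> q) :
  is_sum f g (fadd (bpow q 2) (badd q) H).
Proof. by exists (pair2 _ H); rewrite pair2_pi0 pair2_pi1. Qed.

Lemma is_sum_bsum (X : C) (f g : hom X E) (H : f >> q = g >> q) :
  is_sum f g (bsum q H).
Proof. exact: is_sum_fadd. Qed.

Lemma is_sum_over (X : C) (f g h : hom X E) :
  is_sum f g h -> f >> q = g >> q.
Proof. by case=> u [<- <- _]; rewrite -!compA (wpr_over _ ord0 ord_max). Qed.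

Lemma is_sum_total_over (X : C) (f g h : hom X E) :
  is_sum f g h -> h >> q = f >> q.
Proof.
case=> u [<- _ <-].
by rewrite -!compA (cm_add_over (bmonoid q)) (wpb_over (wis (bpow q 2))).
Qed.

Lemma is_sum_unique (X : C) (f g h h' : hom X E) :
  is_sum f g h -> is_sum f g h' -> h = h'.
Proof.
case=> u [Hf Hg <-] [v [Hf' Hg' <-]]; congr (_ >> _).
by apply: pair2_unique; rewrite ?Hf ?Hg.
Qed.

Lemma is_sum_pre (X Y : C) (v : hom Y X) (f g h : hom X E) :
  is_sum f g h -> is_sum (v >> f) (v >> g) (v >> h).
Proof. by case=> u [<- <- <-]; exists (v >> u); rewrite -!compA. Qed.

Lemma is_sumC (X : C) (f g h : hom X E) : is_sum f g h -> is_sum g f h.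
Proof.
move=> S; have H := is_sum_over S.
have -> : h = bsum q H by exact: is_sum_unique S (is_sum_bsum H).
by rewrite (bsumC H (esym H)); exact: is_sum_bsum.
Qed.

Lemma is_sum0 (X : C) (f : hom X E) : is_sum f (f >> q >> bzero q) f.
Proof.
have H : f >> q = (f >> q >> bzero q) >> q.
  by rewrite -(compA _ (bzero q)) bzero_over compm1.
by rewrite -[X in is_sum _ _ X](bsum0 H); exact: is_sum_bsum.
Qed.

Lemma is_sumA (X : C) (f g h fg gh k : hom X E) :
  is_sum f g fg -> is_sum g h gh -> is_sum fg h k -> is_sum f gh k.
Proof.
move=> Sfg Sgh Sk.
have Hg := is_sum_over Sfg; have Hh := is_sum_over Sgh.
(* Every triple of maps over the base factors through the universal triple in
   [E_3], for which associativity is an axiom. *)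
pose F (i : 'I_3) := nth f [:: f; g; h] i.
have HF i : F i >> q = f >> q.
  by case: i => [[|[|[|]]] //= ?]; rewrite /F /= -?Hh.
pose v := wpb_lift (wis (bpow q 3)) HF.
have Hv i : v >> wpr (bpow q 3) i = F i := wpb_lift_pr (wis (bpow q 3)) HF i.
move: (cm_addA (bmonoid q)).
set HL := (X in fadd _ _ X = _); set HR := (X in _ = fadd _ _ X) => A.
have L := is_sum_pre v (is_sum_fadd HL).
have R := is_sum_pre v (is_sum_fadd HR).
have S01 := is_sum_pre v (is_sum_fadd (wpr_over (bpow q 3)
  (@Ordinal 3 0 isT) (@Ordinal 3 1 isT))).
have S12 := is_sum_pre v (is_sum_fadd (wpr_over (bpow q 3)
  (@Ordinal 3 1 isT) (@Ordinal 3 2 isT))).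
rewrite !Hv in L R S01 S12.
rewrite (is_sum_unique S01 Sfg) in L; rewrite (is_sum_unique S12 Sgh) in R.
by rewrite (is_sum_unique Sk L) A.
Qed.

End Sums.

Section Negation.
Variables (C : category) (E M : C) (q : additive_bundle E M) (neg : hom E E).
Hypothesis negP : is_sum q (idmap E) neg (q >> bzero q).

(** Any fibrewise negation turns differences into statements about sums; it
    serves for the tangent bundle and for a differential bundle, whose
    negations are given in different ways. *)
Lemma is_sum_neg (X : C) (f g d : hom X E) :
  is_sum q f (g >> neg) d <-> is_sum q d g f.
Proof.
have negr (Y : C) (k : hom Y E) : is_sum q k (k >> neg) (k >> q >> bzero q).
  by have := is_sum_pre k negP; rewrite compm1 compA.
have negl (Y : C) (k : hom Y E) := is_sumC (negr Y k).
split=> S.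
- have Hq : f >> q = g >> q.
    by rewrite (is_sum_over S) -(is_sum_total_over (negl X g)) -compA
               bzero_over compm1.
  have Hd : d >> q = g >> q by rewrite (is_sum_total_over S).
  have D := is_sum_bsum Hd.
  have := is_sumA S (negl _ g) D.
  rewrite -Hq => F; rewrite (is_sum_unique (is_sum0 q f) F); exact: D.
- have Hg := is_sum_over S.
  have Hn : f >> q = (g >> neg) >> q.
    rewrite (is_sum_total_over S) Hg -(is_sum_total_over (negl X g)) -compA.
    by rewrite bzero_over compm1.
  have F := is_sum_bsum Hn.
  have := is_sumA S (negr _ g) F.
  rewrite -Hg => G; rewrite (is_sum_unique (is_sum0 q d) G); exact: F.
Qed.

End Negation.

(** * Maps that preserve sums *)

(** Only the total map is mentioned: a map of total spaces may preserve sums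
    without a chosen map of bases, and in this form the property is stable
    under composition with no square to carry along. *)
Definition preserves_sums (C : category) (E M E' M' : C)
    (q : additive_bundle E M) (q' : additive_bundle E' M') (f : hom E E') :=
  forall (X : C) (u v w : hom X E),
    is_sum q u v w -> is_sum q' (u >> f) (v >> f) (w >> f).

Lemma additive_morphism_preserves_sums (C : category) (E M E' M' : C)
    (q : additive_bundle E M) (q' : additive_bundle E' M')
    (f1 : hom E E') (f0 : hom M M') :
  additive_morphism q q' f1 f0 -> preserves_sums q q' f1.
Proof.
move=> A X u v w [x [<- <- <-]]; rewrite -!compA (am_add A).
exact: is_sum_pre (is_sum_bsum _).
Qed.

Lemma is_sum_fmap (C D : category) (F : functor C D) (E M : C)
    (q : additive_bundle E M) (HF : forall n, preserves_wpb F (bpow q n))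
    (X : C) (u v w : hom X E) :
  is_sum q u v w ->
  is_sum (map_bundle HF) (fmap F u) (fmap F v) (fmap F w).
Proof. by case=> x [<- <- <-]; exists (fmap F x); rewrite !fmap_comp. Qed.

Lemma fmap_preserves_sums (C D : category) (F : functor C D) (E M E' M' : C)
    (q : additive_bundle E M) (HF : forall n, preserves_wpb F (bpow q n))
    (q' : additive_bundle E' M') (HF' : forall n, preserves_wpb F (bpow q' n))
    (f : hom E E') :
  preserves_sums q q' f ->
  preserves_sums (map_bundle HF) (map_bundle HF') (fmap F f).
Proof.
move=> Hf X u v w [x [<- <- <-]].
have S : is_sum q (pi0 (bpow q 2)) (pi1 (bpow q 2)) (badd q).
  by exists (idmap _); rewrite !comp1m.
have := is_sum_pre x (is_sum_fmap HF' (Hf _ _ _ _ S)).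
by rewrite !fmap_comp !compA.
Qed.

(** * Sums in tangent bundles *)

Section TangentSums.
Variables (C : category) (T : additive_tangent C).

(** This is naturality of the addition of the tangent bundle, whence no
    condition on [h]. *)
Lemma tan_preserves_sums (M N : C) (h : hom M N) :
  preserves_sums (tan_bundle T M) (tan_bundle T N) (fmap T h).
Proof.
move=> X u v w [x [<- <- <-]].
exists (x >> fmap (power_functor (fun M => tpow T M 2)) h).
rewrite -!compA -(naturality (tadd T)) /=.
by rewrite !(wpb_lift_pr (wis (tpow T N 2))).
Qed.

Lemma tp_preserves_sums (E M : C) (q : additive_bundle E M)
    (HT : forall n, preserves_wpb T (bpow q n)) :
  preserves_sums (map_bundle HT) q (tp T E).
Proof.
move=> X u v w [x [<- <- <-]]; exists (x >> tp T _).
by rewrite -!compA /= !(naturality (tp T)).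
Qed.

Lemma tan_negP (n : negatives T) (M : C) :
  is_sum (tan_bundle T M) (idmap (T M)) (n M) (tp T M >> tzero T M).
Proof. by rewrite -(tn_add n M); exact: is_sum_bsum. Qed.

Lemma is_sum_tsub (n : negatives T) (M X : C) (f g : hom X (T M))
    (H : f >> tp T M = g >> tp T M) :
  is_sum (tan_bundle T M) (tsub n H) g f.
Proof. by apply/(is_sum_neg (tan_negP n M)); exact: is_sum_bsum. Qed.

End TangentSums.

Section TangentLift.
Variables (C : category) (T : tangent_structure C) (M : C).

Lemma tl_p : tl T M >> tp T (T M) = tp T M >> tzero T M.
Proof.
rewrite -(tc_Tp T M) compA tl_tc.
exact: am_square (tl_additive T M).
Qed.

(** The axioms say that [l] is additive into [T(p)]; as [l c = l] and [c]
    exchanges the two bundle structures of [T (T M)], it is additive into [p]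
    too. *)
Lemma tl_preserves_sums :
  preserves_sums (tan_bundle T M) (tan_bundle T (T M)) (tl T M).
Proof.
move=> X u v w S; rewrite -(tl_tc T M) !compA.
apply: (additive_morphism_preserves_sums (tc_additive T M)).
exact: (additive_morphism_preserves_sums (tl_additive T M)).
Qed.

End TangentLift.

(** * Brackets and universality of the lift *)

Section BracketSum.
Variables (C : category) (T : additive_tangent C) (E M : C).
Variable q : additive_bundle E M.
Variable HT : forall n, preserves_wpb T (bpow q n).
Variable l : hom E (T E).
Hypothesis l_over : l >> fmap T q = q >> tzero T M.
Hypothesis l_p : l >> tp T E = q >> bzero q.
Hypothesis univ : lift_universal HT l_over 0.

Lemma is_sum_mu (X : C) (u : hom X (bpow q 2)) :
  is_sum (map_bundle HT) (u >> pi0 (bpow q 2) >> l)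
    (u >> pi1 (bpow q 2) >> tzero T E) (u >> mu HT l_over).
Proof.
rewrite -!compA; apply: is_sum_pre.
exact: (is_sum_bsum (q := map_bundle HT) (mu_over l_over)).
Qed.

(** The factorisation of [f] through [mu] has two components.  The first is the
    bracket; the second is recovered by projecting with [p], which sends
    the lifted component to zero and is a retraction of [0]. *)
Lemma bracket_decomposition (X : C) (f : hom X (T E))
    (Hf : f >> fmap T q = f >> tp T E >> q >> tzero T M) :
  is_sum (map_bundle HT) (bracket univ Hf >> l) (f >> tp T E >> tzero T E) f.
Proof.
rewrite /bracket; set u := pb_lift univ Hf.
have Hu : u >> mu HT l_over = f := pb_lift_top univ Hf.
have S := is_sum_mu u; rewrite Hu in S.
have zp : tzero T E >> tp T E = idmap E := bzero_over (tan_bundle T E).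
have Sp := tp_preserves_sums S.
rewrite -(compA _ l) l_p -(compA _ (tzero T E)) zp compm1 compA in Sp.
have H1 : u >> pi0 (bpow q 2) >> q = u >> pi1 (bpow q 2) >> q.
  by rewrite -!compA (wpr_over _ ord0 ord_max).
rewrite H1 in Sp.
by rewrite (is_sum_unique (is_sumC Sp) (is_sum0 q _)) in S *.
Qed.

(** Restricted to the pairs whose second component is zero, [mu] is the lift,
    and [mu] together with the projection to the base is jointly monic. *)
Lemma lift_mono (X : C) (f g : hom X E) : f >> l = g >> l -> f = g.
Proof.
move=> H; have Hq : f >> q = g >> q.
  have := congr1 (fun x => x >> tp T E >> q) H.
  by rewrite /= -!(compA _ l) l_p -!compA bzero_over !compm1.
have zz (k : hom X E) : k >> q = (k >> q >> bzero q) >> q.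
  by rewrite -(compA _ (bzero q)) bzero_over compm1.
have liftE (k : hom X E) : pair2 (bpow q 2) (zz k) >> mu HT l_over = k >> l.
  have S := is_sum_mu (pair2 (bpow q 2) (zz k)).
  rewrite pair2_pi0 pair2_pi1 in S.
  have Hz : k >> l >> fmap T q >> fmap T (bzero q)
            = k >> q >> bzero q >> tzero T E.
    by rewrite -(compA k l) l_over -!compA -(naturality (tzero T)).
  apply: is_sum_unique S _; rewrite -Hz.
  exact: (is_sum0 (map_bundle HT)).
have E2 : pair2 (bpow q 2) (zz f) = pair2 (bpow q 2) (zz g).
  apply: (pb_unique univ); first by rewrite /= !liftE.
  by rewrite /= !compA !pair2_pi0.
by rewrite -(pair2_pi0 (bpow q 2) (zz f)) E2 pair2_pi0.
Qed.

End BracketSum.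

(** * Differential bundles with negatives *)

Section DifferentialBundle.
Variables (C : category) (T : tangent_structure C) (E M : C).
Variable q : differential_bundle T E M.

Lemma lam_mono (X : C) (f g : hom X E) : f >> lam q = g >> lam q -> f = g.
Proof. exact: (lift_mono (lam_p q) (lam_universal q 0)). Qed.

Lemma lam_zero : bzero q >> lam q = bzero q >> tzero T E.
Proof.
rewrite (am_zero (lam_additive_T q)) /=.
by rewrite -(naturality (tzero T)).
Qed.

(** Being additive and monic, the lift embeds addition in [q] into addition in
    the tangent bundle. *)
Lemma lam_reflects_sums (X : C) (u v w : hom X E) :
  is_sum (tan_bundle T E) (u >> lam q) (v >> lam q) (w >> lam q) ->
  is_sum q u v w.
Proof.
move=> S; have H : u >> q = v >> q.
  have := congr1 (fun x => x >> q) (is_sum_over S).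
  by rewrite /= -!(compA _ (lam q)) lam_p -!compA bzero_over !compm1.
have S1 := is_sum_bsum H.
suff <- : bsum q H = w by [].
apply: lam_mono.
have S2 := additive_morphism_preserves_sums (lam_additive_p q) S1.
exact: is_sum_unique S2 S.
Qed.

(** The negation of [q] is the restriction of that of the tangent bundle along
    the lift, since the second component of [lam q >> n E] is zero. *)
Lemma db_neg_lam (n : negatives T) : db_neg n q >> lam q = lam q >> n E.
Proof.
have S := bracket_decomposition (lam_p q) (lam_universal q 0)
  (db_neg_over n q).
rewrite -(compA _ (n E)) tn_over lam_p -(compA _ (bzero q)) -lam_zero in S.
have S0 := is_sum0 (map_bundle (F := T) (fun m => db_pow_preserved q m 1))
  (db_neg n q >> lam q).
suff Hz : db_neg n q >> lam q >> fmap T q >> fmap T (bzero q)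
          = q >> (bzero q >> lam q).
  by rewrite /= Hz in S0; exact: is_sum_unique S0 S.
rewrite -(compA (db_neg n q)) (am_square (lam_additive_T q)) !compA.
by rewrite db_neg_proj -!compA (am_zero (lam_additive_T q)).
Qed.

Lemma db_negP (n : negatives T) :
  is_sum q (idmap E) (db_neg n q) (q >> bzero q).
Proof.
apply: lam_reflects_sums.
rewrite db_neg_lam comp1m -(compA _ (bzero q)) lam_zero compA -lam_p -compA.
by have := is_sum_pre (lam q) (tan_negP n E); rewrite compm1.
Qed.

Lemma is_sum_db_sub (n : negatives T) (X : C) (f g : hom X E)
    (H : f >> q = g >> q) :
  is_sum q (db_sub n H) g f.
Proof. by apply/(is_sum_neg (db_negP n)); exact: is_sum_bsum. Qed.

Lemma db_sub_unique (n : negatives T) (X : C) (f g d : hom X E)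
    (H : f >> q = g >> q) :
  is_sum q d g f -> db_sub n H = d.
Proof.
move/(is_sum_neg (db_negP n)); apply: is_sum_unique; exact: is_sum_bsum.
Qed.

End DifferentialBundle.

(** * Additivity of a vertical connection *)

Section VerticalConnection.
Variables (C : category) (T : tangent_structure C) (E M : C).
Variables (q : differential_bundle T E M) (K : vertical_connection q).

Let Tq := map_bundle (F := T) (fun m => db_pow_preserved q m 1).

(** After composition with [lam] the axiom [K lam = l T(K)] makes [K] a
    composite of additive maps. *)
Lemma vc_sums_p : preserves_sums (tan_bundle T E) q K.
Proof.
move=> X u v w S; apply: lam_reflects_sums.
rewrite -!(compA _ K) (vc_linear_p K) !compA.
by apply: tan_preserves_sums; exact: tl_preserves_sums.
Qed.

(** The same argument with [K lam = T(lam) c T(K)]: here [T(lam)] leads from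
    [T(q)] to [T(p)], and [c] from there to [p]. *)
Lemma vc_sums_T : preserves_sums Tq q K.
Proof.
move=> X u v w S; apply: lam_reflects_sums.
rewrite -!(compA _ K) (vc_linear_T K) !compA.
apply: tan_preserves_sums.
apply: (additive_morphism_preserves_sums (tc_additive T E)).
apply: fmap_preserves_sums S.
exact: additive_morphism_preserves_sums (lam_additive_p q).
Qed.

(** The linearity axiom yields [0 K lam = 0 K 0].  Projecting with [p] reads the
    right-hand side as [0 K] and the left-hand side as a zero. *)
Lemma vc_zero : tzero T E >> K = q >> bzero q.
Proof.
have z1 : tzero T E >> tp T E = idmap E := bzero_over (tan_bundle T E).
have H : tzero T E >> K >> lam q = tzero T E >> K >> tzero T E.
  rewrite -compA (vc_linear_p K) compA.
  have /= -> := am_zero (tl_additive T E).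
  by rewrite -compA -(fmap_comp T) -(naturality (tzero T)).
have := congr1 (fun x => x >> tp T E) H.
by rewrite /= -!(compA _ (tzero T E)) z1 compm1 -(compA _ (lam q)) lam_p
  compA -(compA _ K) (vc_proj K) compA z1 comp1m.
Qed.

(** * Connections and brackets of tangent vectors *)

(** A map [f] sent to zeros by [T(p)] is the lift of its bracket plus a zero vector;
    [T(h)] and [K] preserve this sum, and they send the zero vector to zero. *)
Lemma tan_bracket_connection (h : hom (T M) E) (X : C) (f : hom X (T (T M)))
    (Hf : f >> fmap T (tp T M) = f >> tp T (T M) >> tp T M >> tzero T M) :
  preserves_sums (tan_bundle T M) q h ->
  tan_bracket Hf >> tl T M >> fmap T h >> K = f >> fmap T h >> K.
Proof.
move=> Ph.
have S := bracket_decomposition (q := tan_bundle T M) (tl_p T M)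
  (tl_universal T M 0) Hf.
have Sh := vc_sums_T (fmap_preserves_sums
  (fun m => db_pow_preserved q m 1) Ph S).
have z : tzero T (T M) >> fmap T h >> K = h >> q >> bzero q.
  by rewrite -(naturality (tzero T) h) /= -compA vc_zero compA.
rewrite -!(compA (f >> _)) z !compA in Sh.
have Hq := is_sum_over Sh.
rewrite -(compA _ (bzero q)) bzero_over compm1 in Hq.
rewrite -Hq in Sh.
exact: is_sum_unique (is_sum0 _ _) Sh.
Qed.

Variable s : bsection q.

Lemma covariant_preserves_sums :
  preserves_sums (tan_bundle T M) q (fmap T s >> K).
Proof.
move=> X u v w S; rewrite !compA.
by apply: vc_sums_p; exact: tan_preserves_sums.
Qed.

(** Naturality of [l] reduces this to [l T(K) K = K lam K = K]. *)
Lemma tl_covariant :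
  tl T M >> fmap T (fmap T s >> K) >> K = fmap T s >> K.
Proof.
rewrite fmap_comp compA.
have /= <- := naturality (tl T) s.
by rewrite -(compA _ (tl T E)) -(vc_linear_p K) -!compA (vc_retract K) compm1.
Qed.

Lemma tan_bracket_covariant (X : C) (f : hom X (T (T M)))
    (Hf : f >> fmap T (tp T M) = f >> tp T (T M) >> tp T M >> tzero T M) :
  tan_bracket Hf >> (fmap T s >> K) = f >> fmap T (fmap T s >> K) >> K.
Proof.
rewrite -(tan_bracket_connection Hf covariant_preserves_sums).
by rewrite -!(compA (tan_bracket Hf)) tl_covariant.
Qed.

End VerticalConnection.

Theorem proposition3p22 (C : category) (T : tangent_structure C)
    (n : negatives T) (E M : C) (q : differential_bundle T E M)
    (K : vertical_connection q) (w1 w2 : vector_field T M) (s : bsection q) :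
  curvature_tensor n K w1 w2 s =
  section_sub n
    (section_sub n (nabla K w1 (nabla K w2 s)) (nabla K w2 (nabla K w1 s)))
    (nabla K (lie_bracket n w1 w2) s).
Proof.
set N := nabla K w2 (nabla K w1 s).
set h := fmap T s >> K.
have XN (w v : vector_field T M) :
    v >> fmap T w >> fmap T h >> K = nabla K v (nabla K w s).
  by rewrite /= -(compA v) -fmap_comp compA.
pose b := w2 >> fmap T w1 >> tc T M.
have R : is_sum q (curvature_tensor n K w1 w2 s) N (b >> fmap T h >> K).
  have := is_sum_pre (w2 >> fmap T w1 >> fmap T (fmap T s))
    (is_sum_db_sub n (curvature_over K)).
  rewrite -/(curvature n K) -/(curvature_tensor n K w1 w2 s).
  congr (is_sum _ _ _ _).
    by rewrite /N -XN /h !fmap_comp !compA.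
  rewrite !compA -!(compA _ _ (tc T E)).
  have /= -> := naturality (tc T) s.
  by rewrite /b /h !fmap_comp !compA.
set L := nabla K (lie_bracket n w1 w2) s.
have SL : is_sum q L (b >> fmap T h >> K) (nabla K w1 (nabla K w2 s)).
  have D := is_sum_tsub n (lie_sub_over w1 w2).
  have := vc_sums_p K (tan_preserves_sums h D).
  rewrite -(tan_bracket_covariant K s (lie_bracket_over n w1 w2)).
  by rewrite XN /L /= compA.
set X := nabla K w1 (nabla K w2 s) in SL *.
(* With [R], [N] and [L] for the curvature term, [nabla w2 (nabla w1 s)] and
   the bracket term, [(L + R) + N = L + (R + N) = X]; hence [R = (X - N) - L]. *)
have HA : curvature_tensor n K w1 w2 s >> q = L >> q.
  by rewrite (is_sum_over R) !sec_proj.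
have Sk := is_sum_bsum HA.
have HN : bsum q HA >> q = N >> q by rewrite bsum_over HA !sec_proj.
have Sm := is_sum_bsum HN.
have Em := is_sum_unique (is_sumA (is_sumC Sk) R Sm) SL.
rewrite Em in Sm.
apply/esym/db_sub_unique; rewrite /=.
by rewrite (db_sub_unique n _ Sm).
Qed.
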